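(* There is a constant $c$ and a choice of the parameter $G=\Theta(\log(1/\beta))$ such that for every $\beta\in(0,1)$, every $\varepsilon>0$, all positive integers $m\le n$ (with $G$ dividing $n$), every even $d$, and every attacker $M$: with probability at least $1-\beta$, \[ \mathrm{Manip}_{m,n}(\mathtt{RAPTOR}_{n,G,\varepsilon},\mathbf U,M)=\text{``Uniform''}, \] and for every distribution $\mathbf P$ on $[d]$ with $\|\mathbf P-\mathbf U\|_1\ge c\cdot\frac{e^\varepsilon+1}{e^\varepsilon-1}\left(\sqrt{\frac{dG}{n}\ln\frac G\beta}+\frac{mG\sqrt d}{n}\right)$, with probability at least $1-\beta$, \[ \mathrm{Manip}_{m,n}(\mathtt{RAPTOR}_{n,G,\varepsilon},\mathbf P,M)=\text{``Not uniform''}. \]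
   Context: $\mathbf U$ is the uniform distribution on $[d]$; $\|\mathbf P-\mathbf U\|_1=\sum_{j\in[d]}|\mathbf P(j)-\mathbf U(j)|$. Randomized response: for $b\in\{\pm1\}$, $R^{RR}_\varepsilon(b)$ outputs $b\cdot\frac{e^\varepsilon+1}{e^\varepsilon-1}$ with probability $\frac{e^\varepsilon}{e^\varepsilon+1}$ and $-b\cdot\frac{e^\varepsilon+1}{e^\varepsilon-1}$ otherwise. Protocol $\mathtt{RAPTOR}_{n,G,\varepsilon}$ (with parameters $m,\beta$ known to the aggregator): public randomness consists of independent uniformly random subsets $S_1,\dots,S_G\subset[d]$ of size $d/2$. Users are split into $G$ contiguous groups; group $g$ consists of users $i$ with $1+(g-1)n/G\le i\le gn/G$. A user $i$ in group $g$ with data $x_i\in[d]$ sets $x_i'=+1$ if $x_i\in S_g$ and $x_i'=-1$ otherwise, and sends $y_i\sim R^{RR}_\varepsilon(x_i')$. The aggregator sets $\alpha_G=\frac{e^\varepsilon+1}{e^\varepsilon-1}\left(\sqrt{\frac{6G}{n}\ln\frac{4G}{\beta}}+\frac{2mG}{n}\right)$, computes $\tilde p(S_g)=\frac Gn\sum_{i\text{ in group }g}y_i$ for each $g$, and outputs ``Not uniform'' if $|\tilde p(S_g)|>2\alpha_G$ for some $g$, and ``Uniform'' otherwise. Manipulation game $\mathrm{Manip}_{m,n}(\Pi,\mathbf P,M)$: the data $x_1,\dots,x_n$ are drawn i.i.d. from $\mathbf P$; the public randomness $S$ is sampled; the attacker $M$ chooses a set $C\subseteq[n]$ with $|C|=m$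 and messages $y_i\in\{\pm\frac{e^\varepsilon+1}{e^\varepsilon-1}\}$ for $i\in C$ (possibly depending on the data, $S$, and its own randomness); each $i\notin C$ independently sends its honest message; the output is the aggregator's output on $(y_1,\dots,y_n)$ and $S$. *)

(* Defs.v *)
From mathcomp Require Import all_boot.
From Stdlib Require Import Reals.


Open Scope R_scope.

Definition Rsum {T : finType} (F : T -> R) : R := \big[Rplus/0]_(t : T) F t.
Definition Rprod {T : finType} (F : T -> R) : R := \big[Rmult/1]_(t : T) F t.
Definition indic (b : bool) : R := if b then 1 else 0.
Definition Rltb (a b : R) : bool := if Rlt_dec a b then true else false.

Definition is_distr (d : nat) (P : 'I_d -> R) : Prop :=
  (forall j, 0 <= P j) /\ Rsum P = 1.
Definition unif (d : nat) : 'I_d -> R := fun _ => / INR d.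
Definition L1dist (d : nat) (P Q : 'I_d -> R) : R :=
  Rsum (fun j : 'I_d => Rabs (P j - Q j)).

Definition kappa (eps : R) : R := (exp eps + 1) / (exp eps - 1).
Definition keep_prob (eps : R) : R := exp eps / (exp eps + 1).
Definition msg_val (eps : R) (b : bool) : R := if b then kappa eps else - kappa eps.

(* users are 'I_n (0-based); user i is in group (0-based) i / (n/G) *)
Definition group_of (n G : nat) (i : 'I_n) : nat := (i %/ (n %/ G))%nat.

(* public randomness: S_1..S_G, each a subset of [d] of size d/2 *)
Definition validS (G d : nat) (S : {ffun 'I_G -> {set 'I_d}}) : bool :=
  [forall g : 'I_G, #|S g| == (d %/ 2)%nat].

(* x_i' = +1 iff x_i \in S_{g(i)} *)
Definition encode (n G d : nat) (x : {ffun 'I_n -> 'I_d})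
  (S : {ffun 'I_G -> {set 'I_d}}) (i : 'I_n) : bool :=
  [exists g : 'I_G, (nat_of_ord g == group_of n G i) && (x i \in S g)].

(* An attacker: given data x and public randomness S, a probability
   distribution (kernel) over pairs (C, z) where C is the corrupted set
   (|C| = m) and z i is the message sent by i \in C (z i ignored off C). *)
Definition attacker (n d G : nat) : Type :=
  {ffun 'I_n -> 'I_d} -> {ffun 'I_G -> {set 'I_d}} ->
  ({set 'I_n} * {ffun 'I_n -> bool})%type -> R.

Definition valid_attacker (n d G m : nat) (M : attacker n d G) : Prop :=
  (forall x S o, 0 <= M x S o) /\
  (forall x S, Rsum (M x S) = 1) /\
  (forall x S o, M x S o <> 0 -> #|o.1| = m).

(* honest randomness h : h i = true means randomized response keeps the bit *)
Definition honest_prob (n : nat) (eps : R) (h : {ffun 'I_n -> bool}) : R :=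
  Rprod (fun i : 'I_n => if h i then keep_prob eps else 1 - keep_prob eps).

Definition final_msg (n G d : nat) (x : {ffun 'I_n -> 'I_d})
  (S : {ffun 'I_G -> {set 'I_d}}) (o : ({set 'I_n} * {ffun 'I_n -> bool})%type)
  (h : {ffun 'I_n -> bool}) (i : 'I_n) : bool :=
  if i \in o.1 then o.2 i
  else (if h i then encode n G d x S i else ~~ encode n G d x S i).

Definition alphaG (n G m : nat) (eps beta : R) : R :=
  kappa eps * (sqrt (6 * INR G / INR n * ln (4 * INR G / beta))
               + 2 * INR m * INR G / INR n).

Definition ptilde (n G : nat) (eps : R) (y : 'I_n -> bool) (g : 'I_G) : R :=
  INR G / INR n *
  \big[Rplus/0]_(i : 'I_n | group_of n G i == nat_of_ord g) msg_val eps (y i).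

(* true = "Not uniform", false = "Uniform" *)
Definition raptor_rejects (n G m : nat) (eps beta : R) (y : 'I_n -> bool) : bool :=
  [exists g : 'I_G, Rltb (2 * alphaG n G m eps beta) (Rabs (ptilde n G eps y g))].

Definition manip_prob (n G d m : nat) (eps beta : R) (P : 'I_d -> R)
  (M : attacker n d G) (out : bool) : R :=
  Rsum (fun x : {ffun 'I_n -> 'I_d} =>
    Rprod (fun i : 'I_n => P (x i)) *
    (/ INR #|[set S : {ffun 'I_G -> {set 'I_d}} | validS G d S]| *
     \big[Rplus/0]_(S : {ffun 'I_G -> {set 'I_d}} | validS G d S)
       Rsum (fun o : ({set 'I_n} * {ffun 'I_n -> bool})%type => M x S o *
         Rsum (fun h : {ffun 'I_n -> bool} => honest_prob n eps h *
           indic (raptor_rejects n G m eps beta (final_msg n G d x S o h) == out))))).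

(* Main.v *)
Require Import Defs.
From HB Require Import structures.
From mathcomp Require Import all_boot.
From mathcomp Require Import perm.
From Stdlib Require Import Reals Lra ZArith.
Open Scope R_scope.

(* Fix the public sets. Every honest message has mean [sgn_dot P S_g] (the
   excess of P-mass inside S_g), so an exponential moment bound and a union
   bound keep all group averages of honest messages within [2 kappa noise] of
   their means; the [m] corrupted users, whatever they know, move an average by
   at most [2 kappa m G / n]. For uniform data the means vanish. Otherwise put
   q = P - U and Y = sgn_dot q S for a random half-size set S. Comparing S with
   its image under a transposition of two points gives E Y^2 >= |q|_2^2 and
   E Y^4 <= 6 |q|_2^2 E Y^2, so by a Paley-Zygmund argument
   |Y| >= |q|_2 / 2 >= |q|_1 / (2 sqrt d) with probability at least 1/12, and
   12 ln (2 / beta) independent sets contain such an S with probability at least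
   1 - beta / 2. *)

(** * Finite sums and products over the reals *)

HB.instance Definition _ := Monoid.isComLaw.Build R 0 Rplus
  (fun x y z => esym (Rplus_assoc x y z)) Rplus_comm Rplus_0_l.
HB.instance Definition _ := Monoid.isComLaw.Build R 1 Rmult
  (fun x y z => esym (Rmult_assoc x y z)) Rmult_comm Rmult_1_l.
HB.instance Definition _ := Monoid.isMulLaw.Build R 0 Rmult Rmult_0_l Rmult_0_r.
HB.instance Definition _ := Monoid.isAddLaw.Build R Rmult Rplus
  Rmult_plus_distr_r Rmult_plus_distr_l.

Section BigR.
Variable T : finType.
Implicit Types (P : pred T) (F : T -> R).

Lemma bigR_le P F1 F2 : (forall i, P i -> F1 i <= F2 i) ->
  \big[Rplus/0]_(i | P i) F1 i <= \big[Rplus/0]_(i | P i) F2 i.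
Proof. move=> le12; elim/big_ind2: _ => //; [lra | move=> *; lra]. Qed.

Lemma bigR_ge0 P F : (forall i, P i -> 0 <= F i) ->
  0 <= \big[Rplus/0]_(i | P i) F i.
Proof. move=> F0; elim/big_ind: _ => //; [lra | move=> *; lra]. Qed.

Lemma bigR_prod_ge0 P F : (forall i, P i -> 0 <= F i) ->
  0 <= \big[Rmult/1]_(i | P i) F i.
Proof. move=> F0; elim/big_ind: _ => //; [lra | exact: Rmult_le_pos]. Qed.

Lemma bigR_prod_le P F1 F2 : (forall i, P i -> 0 <= F1 i <= F2 i) ->
  0 <= \big[Rmult/1]_(i | P i) F1 i <= \big[Rmult/1]_(i | P i) F2 i.
Proof.
move=> le12; elim/big_ind2: _ => //; [lra | move=> x1 x2 y1 y2 Hx Hy].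
by split; [apply: Rmult_le_pos; lra | apply: Rmult_le_compat; lra].
Qed.

Lemma bigR_abs P F :
  Rabs (\big[Rplus/0]_(i | P i) F i) <= \big[Rplus/0]_(i | P i) Rabs (F i).
Proof.
apply: (big_ind2 (fun a b => Rabs a <= b)) => [|x1 x2 y1 y2 Hx Hy|i _].
- by rewrite Rabs_R0; lra.
- by have := Rabs_triang x1 y1; lra.
- exact: Rle_refl.
Qed.

Lemma bigR_exp P F :
  \big[Rmult/1]_(i | P i) exp (F i) = exp (\big[Rplus/0]_(i | P i) F i).
Proof.
by elim/big_rec2: _ => [|i x y _ ->]; rewrite ?exp_0 ?exp_plus.
Qed.

Lemma bigR_scale P F c :
  \big[Rplus/0]_(i | P i) (c * F i) = c * \big[Rplus/0]_(i | P i) F i.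
Proof. by rewrite -big_distrr. Qed.

Lemma bigR_add P F1 F2 : \big[Rplus/0]_(i | P i) (F1 i + F2 i) =
  \big[Rplus/0]_(i | P i) F1 i + \big[Rplus/0]_(i | P i) F2 i.
Proof. by rewrite big_split. Qed.

Lemma bigR_sub P F1 F2 : \big[Rplus/0]_(i | P i) (F1 i - F2 i) =
  \big[Rplus/0]_(i | P i) F1 i - \big[Rplus/0]_(i | P i) F2 i.
Proof. elim/big_rec3: _ => [|i x y z _ ->]; lra. Qed.

Lemma bigR_const P c : \big[Rplus/0]_(i | P i) c = INR #|P| * c.
Proof.
rewrite big_const; elim: #|P| => [|k IH]; first by rewrite /=; lra.
by rewrite iterS IH S_INR; lra.
Qed.

Lemma bigR_constT c : \big[Rplus/0]_(i : T) c = INR #|T| * c.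
Proof. exact: bigR_const. Qed.

Lemma bigR_prod_const P c : \big[Rmult/1]_(i | P i) c = c ^ #|P|.
Proof. by rewrite big_const; elim: #|P| => //= k ->. Qed.

End BigR.

Lemma indic01 b : 0 <= indic b <= 1.
Proof. by case: b => /=; lra. Qed.

Lemma RltbP a b : reflect (a < b) (Rltb a b).
Proof. by rewrite /Rltb; case: Rlt_dec => ?; constructor. Qed.

(** * Signed sums over half-size sets: moments and anticoncentration *)

Section HalfSets.
Variables (T : finType) (k : nat).
Hypothesis card2k : #|T| = (k + k)%nat.

Definition sgn (A : {set T}) (j : T) : R := if j \in A then 1 else -1.

Notation "\half_ A F" := (\big[Rplus/0]_(A : {set T} | #|A| == k) F)
  (at level 36, A name, F at level 36).

Lemma sgn_sq (A : {set T}) j : sgn A j * sgn A j = 1.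
Proof. by rewrite /sgn; case: ifP => _; lra. Qed.

Lemma sgn_sum (A : {set T}) : #|A| = k -> \big[Rplus/0]_j sgn A j = 0.
Proof.
move=> cA; rewrite (bigID (mem A)) /=.
rewrite (eq_bigr (fun=> 1)); last by move=> j jA; rewrite /sgn jA.
rewrite [X in _ + X](eq_bigr (fun=> -1)); last first.
  by move=> j jA; rewrite /sgn (negbTE jA).
rewrite [X in _ + X](eq_bigl (fun j => j \in ~: A)); last by move=> j; rewrite inE.
have := cardsC A; rewrite card2k cA => /addnI cC.
by rewrite !bigR_const cA cC; lra.
Qed.

Definition swap (i j : T) (A : {set T}) : {set T} := tperm i j @^-1: A.

Lemma sgn_swap i j (A : {set T}) a : sgn (swap i j A) a = sgn A (tperm i j a).
Proof. by rewrite /sgn inE. Qed.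

Lemma swap_inv i j : involutive (swap i j).
Proof. by move=> A; apply/setP => a; rewrite !inE tpermK. Qed.

Lemma card_swap i j (A : {set T}) : #|swap i j A| = #|A|.
Proof.
rewrite /swap -(can_imset_pre _ (tpermK i j)).
exact/card_imset/perm_inj.
Qed.

(** [swap i j] is an involution that preserves cardinality, so it permutes the half-size sets. *)
Lemma half_swap i j (F : {set T} -> R) : \half_A F A = \half_A F (swap i j A).
Proof.
rewrite (reindex_inj (inv_inj (swap_inv i j))).
by apply: eq_bigl => A; rewrite card_swap.
Qed.

(** Sums over half-size sets stay unnormalised; dividing them by [nhalf] gives expectations. *)
Definition nhalf : R := \half_A 1.

Lemma nhalf_gt0 : 0 < nhalf.
Proof.
rewrite /nhalf bigR_const Rmult_1_r; apply/lt_0_INR/ltP.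
have -> : #|[pred A : {set T} | #|A| == k]| = 'C(#|T|, k).
  by rewrite -card_draws cardsE; apply: eq_card => A; rewrite !inE.
by rewrite bin_gt0 card2k leq_addr.
Qed.

(** Multiply the vanishing sum of all signs by [sgn A i] and sum over [A]: the term at [i] gives
    [nhalf], and transpositions make the terms at all other points equal. Their common value
    therefore cannot be positive. *)
Lemma half_sgn_prod i j : i != j -> \half_A (sgn A i * sgn A j) <= 0.
Proof.
move=> ij.
have E : \half_A (\big[Rplus/0]_l (sgn A i * sgn A l)) = 0.
  by apply: big1 => A /eqP cA; rewrite bigR_scale sgn_sum // Rmult_0_r.
rewrite exchange_big (bigD1 i) //= in E.
rewrite (eq_bigr (fun=> 1)) in E; last by move=> A _; exact: sgn_sq.
rewrite [X in _ + X](eq_bigr (fun=> \half_A (sgn A i * sgn A j))) in E; last first.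
  move=> l li; rewrite (half_swap j l); apply: eq_bigr => A _.
  by rewrite !sgn_swap tpermL tpermD 1?eq_sym // eq_sym.
rewrite bigR_const -/nhalf in E; have := nhalf_gt0 => N0.
have [//|pos] := Rle_or_lt (\half_A (sgn A i * sgn A j)) 0.
move: E; set c := INR _ => E.
have := Rmult_le_pos c _ (pos_INR _) (Rlt_le _ _ pos).
lra.
Qed.

Variable q : T -> R.
Hypothesis q0 : \big[Rplus/0]_j q j = 0.

Definition sgn_dot (A : {set T}) : R := \big[Rplus/0]_j (sgn A j * q j).
Definition sqnorm : R := \big[Rplus/0]_j (q j * q j).

Local Notation Y := sgn_dot.
Local Notation V := sqnorm.
Local Notation delta A i j := ((sgn A i - sgn A j) * (q i - q j)).

Lemma sgn_dot_swap i j (A : {set T}) : Y (swap i j A) = Y A - delta A i j.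
Proof.
have -> : Y (swap i j A) = \big[Rplus/0]_a (sgn A a * q (tperm i j a)).
  rewrite /Y (reindex_inj (@perm_inj _ (tperm i j))).
  by apply: eq_bigr => a _; rewrite sgn_swap tpermK.
have [<-|ij] := eqVneq i j.
  rewrite (eq_bigr (fun a => sgn A a * q a)) -/(Y A); first lra.
  by move=> a _; rewrite tperm1 perm1.
rewrite /Y (bigD1 i) //= [in RHS](bigD1 i) //=.
rewrite (bigD1 j) 1?eq_sym //= [in RHS](bigD1 j) 1?eq_sym //=.
rewrite tpermL tpermR.
rewrite (eq_bigr (fun a => sgn A a * q a)); first lra.
by move=> a /andP[ai aj]; rewrite tpermD // eq_sym.
Qed.

(** The cross term of the expansion is a multiple of the sum of [q], so it vanishes for every [s]. A
    sign pattern as [s] produces [sgn_dot], and [s = q] produces [sqnorm]. *)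
Lemma sum_pairs (s : T -> R) :
  \big[Rplus/0]_i \big[Rplus/0]_j ((s i - s j) * (q i - q j))
  = 2 * INR #|T| * \big[Rplus/0]_j (s j * q j).
Proof.
rewrite (eq_bigr (fun i => INR #|T| * (s i * q i) +
   \big[Rplus/0]_j (s j * q j) - (\big[Rplus/0]_j s j) * q i)); last first.
  move=> i _.
  rewrite (eq_bigr (fun j => (s i * q i + s j * q j) - (s i * q j + q i * s j))).
    rewrite bigR_sub !bigR_add !bigR_scale q0 bigR_constT. lra.
  by move=> j _; lra.
by rewrite bigR_sub bigR_add !bigR_scale q0 bigR_constT; lra.
Qed.

(* Stein's exchangeable pair (A, swap i j A): swapping negates [sgn A i - sgn A j]. *)
Lemma half_exchange (H : R -> R) :
  4 * INR #|T| * \half_A (Y A * H (Y A)) =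
  \big[Rplus/0]_i \big[Rplus/0]_j
    \half_A (delta A i j * (H (Y A) - H (Y (swap i j A)))).
Proof.
have -> : \big[Rplus/0]_i \big[Rplus/0]_j
    \half_A (delta A i j * (H (Y A) - H (Y (swap i j A)))) =
  \big[Rplus/0]_i \big[Rplus/0]_j (2 * \half_A (delta A i j * H (Y A))).
  apply: eq_bigr => i _; apply: eq_bigr => j _.
  have E : \half_A (delta A i j * H (Y A)) =
           \half_A (-1 * (delta A i j * H (Y (swap i j A)))).
    rewrite (half_swap i j); apply: eq_bigr => A _.
    by rewrite !sgn_swap tpermL tpermR; lra.
  rewrite bigR_scale in E.
  rewrite (eq_bigr (fun A => delta A i j * H (Y A)
                    - delta A i j * H (Y (swap i j A)))); last by move=> A _; lra.
  by rewrite bigR_sub E; lra.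
under eq_bigr => i _ do rewrite bigR_scale exchange_big.
rewrite bigR_scale exchange_big -!bigR_scale; apply: eq_bigr => A _ /=.
under [in RHS]eq_bigr => i _ do under eq_bigr => j _ do rewrite Rmult_comm.
under [in RHS]eq_bigr => i _ do rewrite bigR_scale.
rewrite bigR_scale sum_pairs -/(Y A).
by set y := Y A; set c := INR _; ring.
Qed.

Lemma sum_pairs_sq : \big[Rplus/0]_i \big[Rplus/0]_j ((q i - q j) * (q i - q j))
  = 2 * INR #|T| * V.
Proof. exact: sum_pairs. Qed.

Hypothesis T_gt0 : (0 < #|T|)%nat.

(** Taking [H] to be the identity in [half_exchange] leaves the sum of the squares of [delta]. Since
    signs at distinct points are nonpositively correlated, the squared sign difference averages at
    least 2. *)
Lemma half_moment2 : V * nhalf <= \half_A (Y A * Y A).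
Proof.
have T0 : 0 < INR #|T| by apply/lt_0_INR/ltP.
apply: (Rmult_le_reg_l (4 * INR #|T|)); first lra.
rewrite (half_exchange (fun y => y)).
have -> : 4 * INR #|T| * (V * nhalf) = 2 * nhalf * (2 * INR #|T| * V) by lra.
rewrite -sum_pairs_sq -bigR_scale; apply: bigR_le => i _.
rewrite -bigR_scale; apply: bigR_le => j _.
have [<-|ij] := eqVneq i j.
  rewrite big1; first lra.
  by move=> A _; rewrite /=; lra.
rewrite (eq_bigr (fun A => ((q i - q j) * (q i - q j)) *
   (2 * 1 - 2 * (sgn A i * sgn A j)))); last first.
  move=> A _; rewrite sgn_dot_swap.
  by rewrite /sgn; case: ifP => _; case: ifP => _; ring.
rewrite !bigR_scale bigR_sub !bigR_scale -/nhalf.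
have := half_sgn_prod _ _ ij; have := Rle_0_sqr (q i - q j); rewrite /Rsqr.
set w := (q i - q j) * _; set e := \half_A _; set N := nhalf.
by move=> w0 e0; have := Rmult_le_pos w (- e) w0; lra.
Qed.

Lemma half_moment4 : \half_A (Y A * Y A ^ 3) <= 6 * V * \half_A (Y A * Y A).
Proof.
have T0 : 0 < INR #|T| by apply/lt_0_INR/ltP.
apply: (Rmult_le_reg_l (4 * INR #|T|)); first lra.
rewrite (half_exchange (fun y => y ^ 3)).
set M2 := \half_A (Y A * Y A).
have -> : 4 * INR #|T| * (6 * V * M2) = 12 * M2 * (2 * INR #|T| * V) by lra.
rewrite -sum_pairs_sq -bigR_scale; apply: bigR_le => i _.
rewrite -bigR_scale; apply: bigR_le => j _.
set w := q i - q j.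
(* Both members of the exchangeable pair have the same second moment; splitting [M2] between them
   allows a comparison set by set. *)
have -> : 12 * M2 * (w * w) =
  6 * (w * w) * \half_A (Y A * Y A + Y (swap i j A) * Y (swap i j A)).
  rewrite bigR_add -/M2.
  by rewrite -(half_swap i j (fun A => Y A * Y A)) -/M2; lra.
rewrite -bigR_scale; apply: bigR_le => A _.
have dE : (sgn A i - sgn A j) * w = Y A - Y (swap i j A).
  by rewrite sgn_dot_swap /w; lra.
have w0 : 0 <= w * w by nra.
have le4 : (Y A - Y (swap i j A)) * (Y A - Y (swap i j A)) <= 4 * (w * w).
  by rewrite -dE /sgn; case: ifP => _; case: ifP => _; lra.
rewrite dE.
set y := Y A in le4 *; set z := Y (swap i j A) in le4 *.
have -> : (y - z) * (y ^ 3 - z ^ 3) =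
  ((y - z) * (y - z)) * (y * y + y * z + z * z) by ring.
apply: (Rle_trans _ (4 * (w * w) * (y * y + y * z + z * z))).
  by apply: Rmult_le_compat_r => //; nra.
(* Nonnegativity of [(y - z)^2] amounts to [y^2 + y z + z^2 <= 3/2 (y^2 + z^2)], and
   [4 * 3/2 = 6]. *)
have := Rmult_le_pos _ _ w0 (Rle_0_sqr (y - z)); rewrite /Rsqr; lra.
Qed.

(* Paley-Zygmund, with AM-GM [Y^2 <= Y^4 / (12 V) + 3 V] replacing Cauchy-Schwarz. *)
Lemma half_anticoncentration : 0 < V ->
  \half_A indic (Rltb (Y A * Y A) (V / 4)) <= 11 / 12 * nhalf.
Proof.
move=> V0; have M2 := half_moment2; have M4 := half_moment4.
(* Where [Y^2 < V / 4] the left side is at most [3 V^2]; elsewhere AM-GM gives [Y^4 + 36 V^2]. The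
   constants 39 and 36 cover both cases, and the moment bounds then leave [36 W <= 33 nhalf]. *)
have : \half_A (12 * V * (Y A * Y A)) <= \half_A (39 * V * V * 1 + (Y A * Y A ^ 3)
   - 36 * V * V * indic (Rltb (Y A * Y A) (V / 4))).
  apply: bigR_le => A _; set y := Y A.
  case: RltbP => /= lt.
  + have := Rle_0_sqr (y * y).
    have := Rmult_le_pos V (V / 4 - y * y); rewrite /Rsqr; lra.
  + have := Rle_0_sqr (y * y - 6 * V); have := Rle_0_sqr V; rewrite /Rsqr; lra.
rewrite bigR_scale bigR_sub bigR_add !bigR_scale -/nhalf.
set W := \half_A indic _; set m4 := \half_A (Y A * _ ^ 3) in M4 *.
set m2 := \half_A (Y A * Y A) in M2 M4 *; move=> le.
have M2' := Rmult_le_compat_l V _ _ (Rlt_le _ _ V0) M2.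
have VV := Rmult_lt_0_compat _ _ V0 V0.
by apply: (Rmult_le_reg_l (36 * V * V)); lra.
Qed.

End HalfSets.

(** * Exponential moments of two-point variables *)

Lemma exp_le_compat x y : x <= y -> exp x <= exp y.
Proof.
move=> /Rle_lt_or_eq_dec[xy|->]; last exact: Rle_refl.
exact/Rlt_le/exp_increasing.
Qed.

(** The constant 3/2, weaker than the optimal 1/2, permits a proof from [1 + x <= exp x] alone. For
    [|x| >= 2/3] already [|x| <= 3/2 x^2]; otherwise [exp h <= 1 / (1 - h)] at [h = x / 2] and at
    [- h] is squared. *)
Lemma exp_add_expN_le x : exp x + exp (- x) <= 2 * exp (3 / 2 * (x * x)).
Proof.
have [big|small] := Rle_or_lt (2 / 3) (Rabs x).
  have [xl xr] : x <= 3 / 2 * (x * x) /\ - x <= 3 / 2 * (x * x).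
    by move: big; rewrite /Rabs; case: Rcase_abs => ? ?; split; nra.
  by have := exp_le_compat _ _ xl; have := exp_le_compat _ _ xr; lra.
have [hl hr] : -1 / 3 < x / 2 /\ x / 2 < 1 / 3.
  by move: small; rewrite /Rabs; case: Rcase_abs => ? ?; lra.
have -> : x = x / 2 + x / 2 by lra.
set h := x / 2 in hl hr *.
have -> : - (h + h) = - h + - h by lra.
rewrite !exp_plus.
have ab : exp h * exp (- h) = 1 by rewrite -exp_plus Rplus_opp_r exp_0.
have a1 := exp_ineq1_le h; have b1 := exp_ineq1_le (- h).
have e1 := exp_ineq1_le (3 / 2 * ((h + h) * (h + h))).
set a := exp h in ab a1 *; set b := exp (- h) in ab b1 *.
apply: (Rle_trans _ (2 + 12 * (h * h))); last lra.
have h2 : 0 <= h * h < 1 / 9 by nra.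
have ua : a * (1 - h) <= 1 by nra.
have ub : b * (1 + h) <= 1 by nra.
have ua2 : (a * a) * ((1 - h) * (1 - h)) <= 1.
  have z0 : 0 <= a * (1 - h) by nra.
  nra.
have ub2 : (b * b) * ((1 + h) * (1 + h)) <= 1.
  have z0 : 0 <= b * (1 + h) by nra.
  nra.
have ub3 := Rmult_le_compat_r ((1 - h) * (1 - h)) _ _ (Rle_0_sqr _) ub2.
have ua3 := Rmult_le_compat_r ((1 + h) * (1 + h)) _ _ (Rle_0_sqr _) ua2.
set u := h * h in h2 *.
apply: (Rmult_le_reg_r ((1 - u) * (1 - u))); first nra.
apply: (Rle_trans _ (2 + 2 * u)); first by rewrite /u; lra.
(* This is the difference between [(2 + 12 u) (1 - u)^2] and [2 + 2 u], nonnegative since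
   [u < 1/9]. *)
have : 0 <= u * (6 - 22 * u + 12 * (u * u)) by nra.
lra.
Qed.

(* Both centred moment generating functions [phi l] and [phi (-l)] are at least 1,
   so [phi l <= phi l * phi (-l) <= cosh (2 l)]. *)
Lemma two_point_mgf p l : 0 <= p <= 1 ->
  p * exp (l * (1 - (2 * p - 1))) + (1 - p) * exp (l * (-1 - (2 * p - 1)))
  <= exp (6 * (l * l)).
Proof.
move=> p01.
have -> : l * (1 - (2 * p - 1)) = 2 * l * (1 - p) by lra.
have -> : l * (-1 - (2 * p - 1)) = - (2 * l * p) by lra.
have := exp_add_expN_le (2 * l).
have -> : 3 / 2 * (2 * l * (2 * l)) = 6 * (l * l) by lra.
have C1 : 1 <= exp (6 * (l * l)) by have := exp_ineq1_le (6 * (l * l)); nra.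
have -> : exp (2 * l) = exp (2 * l * (1 - p)) * exp (2 * l * p).
  by rewrite -exp_plus; congr exp; lra.
have -> : exp (- (2 * l)) = exp (- (2 * l * (1 - p))) * exp (- (2 * l * p)).
  by rewrite -exp_plus; congr exp; lra.
have uu : exp (2 * l * (1 - p)) * exp (- (2 * l * (1 - p))) = 1.
  by rewrite -exp_plus Rplus_opp_r exp_0.
have vv : exp (2 * l * p) * exp (- (2 * l * p)) = 1.
  by rewrite -exp_plus Rplus_opp_r exp_0.
have u1 := exp_ineq1_le (- (2 * l * (1 - p))).
have v1 := exp_ineq1_le (2 * l * p).
have u0 := exp_pos (2 * l * (1 - p)); have v0 := exp_pos (- (2 * l * p)).
set C := exp (6 * _) in C1 *.
set u := exp (2 * l * (1 - p)) in uu u0 *; set u' := exp _ in uu u1 *.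
set v := exp (2 * l * p) in vv v1 *; set v' := exp _ in vv v0 *.
move=> cosh.
have phi1 : 1 <= p * u' + (1 - p) * v by nra.
have phi0 : 0 <= p * u + (1 - p) * v' by nra.
apply: (Rle_trans _ ((p * u + (1 - p) * v') * (p * u' + (1 - p) * v))).
  by have := Rmult_le_compat_l _ _ _ phi0 phi1; lra.
have -> : (p * u + (1 - p) * v') * (p * u' + (1 - p) * v) =
  p * p * (u * u') + (1 - p) * (1 - p) * (v * v')
  + p * (1 - p) * (u * v + u' * v') by ring.
rewrite uu vv.
have pq : 0 <= p * (1 - p) by nra.
have := Rmult_le_compat_l _ _ _ pq cosh.
have pp : 0 <= p * p + (1 - p) * (1 - p) by nra.
have := Rmult_le_compat_l _ _ _ pp C1.
lra.
Qed.

(** * Constants of randomized response *)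

Section Keep.
Variable eps : R.
Hypothesis eps0 : 0 < eps.

Lemma exp_eps_gt1 : 1 < exp eps.
Proof. by have := exp_ineq1 eps; lra. Qed.

Lemma kappa_gt0 : 0 < kappa eps.
Proof. by have := exp_eps_gt1; rewrite /kappa => ?; apply: Rdiv_lt_0_compat; lra. Qed.

(** Unbiasedness: the scale [kappa] undoes the shrinkage of a sign by randomized response. *)
Lemma kappa_keep : kappa eps * (2 * keep_prob eps - 1) = 1.
Proof. by have := exp_eps_gt1; rewrite /kappa /keep_prob => ?; field; lra. Qed.

Lemma keep_prob_bounds : 1 / 2 <= keep_prob eps <= 1.
Proof.
have e1 := exp_eps_gt1; rewrite /keep_prob; split.
  by apply: (Rmult_le_reg_r (exp eps + 1)); [lra | field_simplify; lra].
by apply: (Rmult_le_reg_r (exp eps + 1)); [lra | field_simplify; lra].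
Qed.
End Keep.

(** * Honest messages: independence and concentration *)

Definition bsgn (b : bool) : R := if b then 1 else -1.

Definition rr (c b : bool) : bool := if b then c else ~~ c.

Section Honest.
Variables (n d : nat) (eps : R) (P : 'I_d -> R).
Hypothesis eps0 : 0 < eps.
Hypothesis Pd : is_distr d P.

Definition keep_weight (b : bool) : R :=
  if b then keep_prob eps else 1 - keep_prob eps.

(** All [n] users get honest coins here, even those the attacker will corrupt. The coordinates thus
    stay independent although the corrupted set may depend on the data. *)
Definition honest_exp (F : {ffun 'I_n -> 'I_d} -> {ffun 'I_n -> bool} -> R) : R :=
  Rsum (fun x : {ffun 'I_n -> 'I_d} => Rprod (fun i => P (x i)) *
    Rsum (fun h : {ffun 'I_n -> bool} => honest_prob n eps h * F x h)).

Lemma keep_weight_ge0 b : 0 <= keep_weight b.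
Proof. by have := keep_prob_bounds eps eps0; rewrite /keep_weight; case: b; lra. Qed.

Lemma honest_prob_ge0 h : 0 <= honest_prob n eps h.
Proof. by apply: bigR_prod_ge0 => i _; apply: keep_weight_ge0. Qed.

Lemma data_prob_ge0 (x : {ffun 'I_n -> 'I_d}) : 0 <= Rprod (fun i => P (x i)).
Proof. by apply: bigR_prod_ge0 => i _; case: Pd. Qed.

(** Independence across users, by distributing the product over the sums twice: once for the data,
    once for the coins. *)
Lemma honest_exp_prod (f : 'I_n -> 'I_d -> bool -> R) :
  honest_exp (fun x h => \big[Rmult/1]_i f i (x i) (h i)) =
  \big[Rmult/1]_i \big[Rplus/0]_a
     (P a * \big[Rplus/0]_b (keep_weight b * f i a b)).
Proof.
rewrite bigA_distr_bigA; apply: eq_bigr => x _.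
rewrite big_split; congr (_ * _).
rewrite bigA_distr_bigA; apply: eq_bigr => h _.
by rewrite big_split.
Qed.

Lemma honest_exp_le F1 F2 : (forall x h, F1 x h <= F2 x h) ->
  honest_exp F1 <= honest_exp F2.
Proof.
move=> le; apply: bigR_le => x _; apply: Rmult_le_compat_l; first exact: data_prob_ge0.
by apply: bigR_le => h _; apply: Rmult_le_compat_l => //; exact: honest_prob_ge0.
Qed.

Lemma honest_exp_scale c F :
  honest_exp (fun x h => c * F x h) = c * honest_exp F.
Proof.
rewrite /honest_exp /Rsum -bigR_scale; apply: eq_bigr => x _.
have -> : \big[Rplus/0]_h (honest_prob n eps h * (c * F x h)) =
  c * \big[Rplus/0]_h (honest_prob n eps h * F x h).
  by rewrite -bigR_scale; apply: eq_bigr => h _; ring.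
ring.
Qed.

Lemma honest_exp_add F1 F2 : honest_exp (fun x h => F1 x h + F2 x h) =
  honest_exp F1 + honest_exp F2.
Proof.
rewrite /honest_exp /Rsum -bigR_add; apply: eq_bigr => x _.
rewrite -Rmult_plus_distr_l -bigR_add; congr (_ * _).
by apply: eq_bigr => h _; ring.
Qed.

Lemma honest_exp_sum (I : finType) (F : I -> _) :
  honest_exp (fun x h => \big[Rplus/0]_(i : I) F i x h) =
  \big[Rplus/0]_(i : I) honest_exp (F i).
Proof.
rewrite /honest_exp /Rsum exchange_big; apply: eq_bigr => x _.
rewrite bigR_scale exchange_big; congr (_ * _); apply: eq_bigr => h _.
by rewrite bigR_scale.
Qed.

Lemma honest_exp1 : honest_exp (fun _ _ => 1) = 1.
Proof.
have -> : honest_exp (fun _ _ => 1) =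
  honest_exp (fun x h => \big[Rmult/1]_i (fun _ _ _ => 1) i (x i) (h i)).
  by apply: eq_bigr => x _; congr (_ * _); apply: eq_bigr => h _; rewrite big1.
rewrite (honest_exp_prod (fun _ _ _ => 1)) big1 // => i _.
case: Pd => _ P1; rewrite -[RHS]P1; apply: eq_bigr => a _.
by rewrite big_bool /keep_weight /=; ring.
Qed.

Variable A : {set 'I_d}.

Definition rr_mean : R := (2 * keep_prob eps - 1) * sgn_dot _ P A.

Lemma rr_mean_bounds : -1 <= rr_mean <= 1.
Proof.
have kb := keep_prob_bounds eps eps0.
have [P0 P1] := Pd.
have : Rabs (sgn_dot _ P A) <= 1.
  rewrite -P1; apply: Rle_trans (bigR_abs _ _ _) _; apply: bigR_le => j _.
  have := P0 j => Pj; rewrite Rabs_mult (Rabs_pos_eq (P j)) // /sgn.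
  by case: ifP => _; rewrite ?Rabs_Ropp Rabs_R1; lra.
rewrite /rr_mean; set y := sgn_dot _ _ _ => yb.
by have := Rle_abs y; have := Rle_abs (- y); rewrite Rabs_Ropp; nra.
Qed.

(** An honest bit takes two values, so its mean determines its law: it is [true] with probability
    [(1 + rr_mean) / 2]. This is the form required by [two_point_mgf]. *)
Lemma rr_exp (u v : R) :
  \big[Rplus/0]_a (P a * \big[Rplus/0]_b
     (keep_weight b * (if rr (a \in A) b then u else v))) =
  (1 + rr_mean) / 2 * u + (1 - (1 + rr_mean) / 2) * v.
Proof.
rewrite (eq_bigr (fun a => (u + v) / 2 * P a +
  (2 * keep_prob eps - 1) * (u - v) / 2 * (sgn _ A a * P a))); last first.
  move=> a _; rewrite big_bool /keep_weight /= /sgn.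
  by case: (a \in A) => /=; lra.
rewrite bigR_add !bigR_scale -/(sgn_dot _ P A) /rr_mean.
have [_ P1] := Pd; rewrite /Rsum in P1; rewrite P1; lra.
Qed.

Variable Q : pred 'I_n.

Definition deviation (x : {ffun 'I_n -> 'I_d}) (h : {ffun 'I_n -> bool}) : R :=
  \big[Rplus/0]_(i | Q i) (bsgn (rr (x i \in A) (h i)) - rr_mean).

Lemma deviation_mgf l :
  honest_exp (fun x h => exp (l * deviation x h)) <= exp (6 * (l * l)) ^ #|Q|.
Proof.
(* Users outside [Q] contribute the factor 1, so the product runs over all users and factorises. *)
pose f (i : 'I_n) a b :=
  if Q i then exp (l * (bsgn (rr (a \in A) b) - rr_mean)) else 1.
have -> : honest_exp (fun x h => exp (l * deviation x h)) =
  honest_exp (fun x h => \big[Rmult/1]_i f i (x i) (h i)).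
  apply: eq_bigr => x _; congr (_ * _); apply: eq_bigr => h _; congr (_ * _).
  by rewrite -big_mkcond bigR_exp bigR_scale.
rewrite honest_exp_prod -bigR_prod_const [X in _ <= X]big_mkcond.
apply: (proj2 (bigR_prod_le _ _ _ _ _)) => i _; split.
  apply: bigR_ge0 => a _; apply: Rmult_le_pos; first by case: Pd.
  apply: bigR_ge0 => b _; apply: Rmult_le_pos; first exact: keep_weight_ge0.
  by rewrite /f; case: ifP => _; [exact/Rlt_le/exp_pos | lra].
rewrite /f; case: ifP => Qi; last first.
  apply: Req_le; case: Pd => _ P1; rewrite -[RHS]P1; apply: eq_bigr => a _.
  by rewrite big_bool /keep_weight /=; ring.
rewrite (eq_bigr (fun a => P a * \big[Rplus/0]_b (keep_weight b *
   (if rr (a \in A) b then exp (l * (1 - rr_mean)) else exp (l * (-1 - rr_mean)))))).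
  rewrite rr_exp; have := rr_mean_bounds; set r := rr_mean => rb.
  have -> : 1 - r = 1 - (2 * ((1 + r) / 2) - 1) by lra.
  have -> : -1 - r = -1 - (2 * ((1 + r) / 2) - 1) by lra.
  by apply: two_point_mgf; lra.
move=> a _; congr (_ * _); apply: eq_bigr => b _.
by rewrite /bsgn; case: rr.
Qed.

Lemma deviation_tail (t : R) : (0 < #|Q|)%nat -> 0 <= t ->
  honest_exp (fun x h => indic (Rltb t (Rabs (deviation x h)))) <=
  2 * exp (- (t * t / (24 * INR #|Q|))).
Proof.
move=> Q0 t0; have N0 : 0 < INR #|Q| by apply/lt_0_INR/ltP.
(* This [l] minimises the Chernoff exponent [- l t + 6 l^2 N], with value [- t^2 / (24 N)]. *)
set N := INR #|Q| in N0 *; pose l := t / (12 * N).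
have l0 : 0 <= l by apply: Rmult_le_pos => //; apply/Rlt_le/Rinv_0_lt_compat; lra.
have powN : exp (6 * (l * l)) ^ #|Q| = exp (6 * (l * l) * N).
  by rewrite -Rpower_pow ?/Rpower ?ln_exp; [congr exp; rewrite /N; ring | exact: exp_pos].
(* Both tails at once: when [|D| > t], one of the two exponentials is at least [exp (l t)]. *)
apply: (Rle_trans _ (honest_exp (fun x h => exp (- (l * t)) *
   (exp (l * deviation x h) + exp (- l * deviation x h))))).
  apply: honest_exp_le => x h; set D := deviation x h.
  rewrite Rmult_plus_distr_l -!exp_plus.
  have e1 := exp_ineq1_le (- (l * t) + l * D).
  have e2 := exp_ineq1_le (- (l * t) + - l * D).
  have p1 := exp_pos (- (l * t) + l * D); have p2 := exp_pos (- (l * t) + - l * D).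
  case: RltbP => /= lt; last lra.
  by move: lt; rewrite /Rabs; case: Rcase_abs => _ lt; nra.
rewrite honest_exp_scale honest_exp_add.
have := deviation_mgf l; have := deviation_mgf (- l).
have -> : - l * - l = l * l by ring.
rewrite powN => m1 m2.
have -> : - (t * t / (24 * N)) = - (l * t) + 6 * (l * l) * N.
  by rewrite /l; field; lra.
rewrite exp_plus; have := exp_pos (- (l * t)); nra.
Qed.

End Honest.

(** * Groups and the manipulation game *)

Lemma card_group n G (g : 'I_G) : (0 < n)%nat -> (G %| n)%nat ->
  #|[pred i : 'I_n | group_of n G i == g :> nat]| = (n %/ G)%nat.
Proof.
move=> n0 Gn; have G0 : (0 < G)%nat by case: G g Gn => [[]|].
have N0 : (0 < n %/ G)%nat by rewrite divn_gt0 // dvdn_leq.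
have lt (k : 'I_(n %/ G)) : (g * (n %/ G) + k < n)%nat.
  rewrite -[X in (_ < X)%nat](divnK Gn) [X in (_ < X)%nat]mulnC.
  apply: (@leq_trans (g.+1 * (n %/ G))%nat); last by rewrite leq_mul2r ltn_ord orbT.
  by rewrite mulSn addnC ltn_add2r ltn_ord.
(* Group [g] is the block of [n %/ G] consecutive users starting at [g * (n %/ G)]. *)
pose f k : 'I_n := Ordinal (lt k).
have f_inj : injective f.
  by move=> k1 k2 /(f_equal val) /= /addnI /val_inj.
rewrite -[RHS]card_ord -(card_image f_inj); apply: eq_card => i.
rewrite !inE /group_of; apply/eqP/imageP => [ig|[k _ ->]]; last first.
  by rewrite /= divnMDl // divn_small ?addn0 ?ltn_ord.
exists (Ordinal (ltn_pmod i N0)) => //; apply: val_inj.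
by rewrite /= -ig -divn_eq.
Qed.

Section Game.
Variables (n G d m : nat) (eps beta : R).
Hypothesis eps0 : 0 < eps.
Hypothesis d_even : ~~ odd d.
Hypothesis d_gt0 : (0 < d)%nat.
Hypothesis n_gt0 : (0 < n)%nat.
Hypothesis G_dvd : (G %| n)%nat.
Hypothesis G_gt0 : (0 < G)%nat.

Local Notation k := (d %/ 2)%nat.

Lemma card_half : #|'I_d| = (k + k)%nat.
Proof. by rewrite card_ord addnn -muln2 divnK // dvdn2. Qed.

(** The [G] public sets are independent. The case [f = 1] counts the valid families; an indicator
    [f] gives the probability that all sets share a property. *)
Lemma validS_prod (f : {set 'I_d} -> R) :
  \big[Rplus/0]_(S : {ffun 'I_G -> {set 'I_d}} | validS G d S)
     \big[Rmult/1]_g f (S g) =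
  (\big[Rplus/0]_(A : {set 'I_d} | #|A| == k) f A) ^ G.
Proof.
rewrite -[X in _ ^ X](card_ord G) -bigR_prod_const.
rewrite (bigA_distr_big (fun A : {set 'I_d} => #|A| == k) (fun _ A => f A)).
by apply: eq_bigl => S.
Qed.

Lemma validS_count :
  INR #|[set S : {ffun 'I_G -> {set 'I_d}} | validS G d S]| = nhalf 'I_d k ^ G.
Proof.
rewrite -validS_prod cardsE -[LHS]Rmult_1_r -bigR_const.
by apply: eq_bigr => S _; rewrite big1.
Qed.

Lemma validS_count_gt0 :
  0 < INR #|[set S : {ffun 'I_G -> {set 'I_d}} | validS G d S]|.
Proof. by rewrite validS_count; apply/pow_lt/nhalf_gt0/card_half. Qed.

(** Removes the attacker: the lower bound on the outcome indicator does not mention [o], so the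
    kernel sums out to 1. [B] charges failures of the honest randomness at fixed public sets, [T]
    charges unlucky public sets. *)
Lemma manip_prob_lower (P : 'I_d -> R) (M : attacker n d G) (out : bool)
    (B : {ffun 'I_n -> 'I_d} -> {ffun 'I_G -> {set 'I_d}} -> {ffun 'I_n -> bool} -> R)
    (T : {ffun 'I_G -> {set 'I_d}} -> R) (b1 b2 : R) :
  is_distr d P -> valid_attacker n d G m M ->
  (forall x S (o : {set 'I_n} * {ffun 'I_n -> bool}) h,
     validS G d S -> #|o.1| = m -> 1 - B x S h - T S <=
     indic (raptor_rejects n G m eps beta (final_msg n G d x S o h) == out)) ->
  (forall S, validS G d S -> honest_exp n d eps P (fun x h => B x S h) <= b1) ->
  \big[Rplus/0]_(S | validS G d S) T S <=
     b2 * INR #|[set S : {ffun 'I_G -> {set 'I_d}} | validS G d S]| ->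
  1 - b1 - b2 <= manip_prob n G d m eps beta P M out.
Proof.
move=> Pd [M0 [M1 Mm]] lower EB ET.
have K0 := validS_count_gt0.
set K := INR _ in K0 ET.
pose I x S h := 1 - B x S h - T S.
apply: (Rle_trans _ (Rsum (fun x : {ffun 'I_n -> 'I_d} => Rprod (fun i => P (x i)) *
  (/ K * \big[Rplus/0]_(S : {ffun 'I_G -> {set 'I_d}} | validS G d S)
     Rsum (fun h : {ffun 'I_n -> bool} => honest_prob n eps h * I x S h))))).
  have -> : Rsum (fun x : {ffun 'I_n -> 'I_d} => Rprod (fun i => P (x i)) *
    (/ K * \big[Rplus/0]_(S : {ffun 'I_G -> {set 'I_d}} | validS G d S)
       Rsum (fun h : {ffun 'I_n -> bool} => honest_prob n eps h * I x S h))) =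
    / K * \big[Rplus/0]_(S | validS G d S) honest_exp n d eps P (fun x h => I x S h).
    rewrite /honest_exp /Rsum [in RHS]exchange_big -bigR_scale.
    apply: eq_bigr => x _; rewrite bigR_scale.
    by set p := Rprod _; set s := \big[Rplus/0]_(i | _) _; ring.
  apply: (Rmult_le_reg_l K) => //; rewrite -Rmult_assoc Rinv_r ?Rmult_1_l; last lra.
  apply: (Rle_trans _ (\big[Rplus/0]_(S | validS G d S) ((1 - b1) - T S))).
    rewrite bigR_sub bigR_const -cardsE -/K; lra.
  apply: bigR_le => S vS.
  have -> : honest_exp n d eps P (fun x h => I x S h) =
    honest_exp n d eps P (fun x h => (1 - T S) * 1 + -1 * B x S h).
    apply: eq_bigr => x _; congr (_ * _); apply: eq_bigr => h _.
    by rewrite /I; ring.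
  rewrite honest_exp_add !honest_exp_scale honest_exp1 //.
  by have := EB S vS; lra.
apply: bigR_le => x _; apply: Rmult_le_compat_l; first exact: data_prob_ge0.
apply: Rmult_le_compat_l; first exact/Rlt_le/Rinv_0_lt_compat.
apply: bigR_le => S vS; rewrite -[X in X <= _]Rmult_1_l -(M1 x S) Rmult_comm.
rewrite -bigR_scale; apply: bigR_le => o _.
(* Only outputs of nonzero weight are known to corrupt exactly [m] users. *)
rewrite Rmult_comm; case: (Req_dec (M x S o) 0) => [->|Mo]; first lra.
apply: Rmult_le_compat_l => //; apply: bigR_le => h _.
apply: Rmult_le_compat_l; first exact: honest_prob_ge0.
exact: lower vS (Mm _ _ _ Mo).
Qed.

Definition noise : R := sqrt (6 * INR G / INR n * ln (4 * INR G / beta)).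

Lemma encode_group x S (i : 'I_n) (g : 'I_G) :
  group_of n G i == g :> nat -> encode n G d x S i = (x i \in S g).
Proof.
move=> /eqP ig; apply/existsP/idP => [[g' /andP[/eqP g'i]]|xg].
  by rewrite ig in g'i; rewrite (val_inj g'i).
by exists g; rewrite ig eqxx.
Qed.

Local Notation dev P S g :=
  (deviation n d eps P (S g) (fun i => group_of n G i == nat_of_ord g)).

Lemma n_eq : INR n = INR (n %/ G) * INR G.
Proof. by rewrite -mult_INR multE divnK. Qed.

Lemma INRs_gt0 : 0 < INR G /\ 0 < INR (n %/ G).
Proof.
split; apply/lt_0_INR/ltP => //.
by rewrite divn_gt0 // dvdn_leq.
Qed.

(** A deterministic bound, valid for every attack: the error of a group average splits into the
    deviation of the honest bits and the changes made by corrupted users. *)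
Lemma ptilde_close P x S (o : {set 'I_n} * {ffun 'I_n -> bool}) h (g : 'I_G) :
  Rabs (ptilde n G eps (final_msg n G d x S o h) g - sgn_dot _ P (S g)) <=
  kappa eps * (Rabs (dev P S g x h) / INR (n %/ G)
               + 2 * INR #|o.1| * INR G / INR n).
Proof.
have k0 := kappa_gt0 _ eps0; have kk := kappa_keep _ eps0.
have [G0 N0] := INRs_gt0; have nE := n_eq.
set Q := fun i : 'I_n => group_of n G i == nat_of_ord g.
set r := rr_mean d eps P (S g).
have kr : kappa eps * r = sgn_dot _ P (S g).
  by rewrite /r /rr_mean -Rmult_assoc kk Rmult_1_l.
(* Difference between the sent signs and those honest users would send; only corrupted users
   contribute, each at most 2 in absolute value. *)
pose corr := \big[Rplus/0]_(i | Q i) (bsgn (final_msg n G d x S o h i) -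
   bsgn (rr (x i \in S g) (h i))).
have corr_le : Rabs corr <= 2 * INR #|o.1|.
  apply: Rle_trans (bigR_abs _ _ _) _.
  apply: (Rle_trans _ (\big[Rplus/0]_(i | Q i) (if i \in o.1 then 2 else 0))).
    apply: bigR_le => i Qi; rewrite /final_msg (encode_group _ _ _ _ Qi) -/(rr _ _).
    case: ifP => _; last by rewrite Rminus_diag Rabs_R0; lra.
    by rewrite /bsgn; case: (o.2 i); case: rr; rewrite /Rabs; case: Rcase_abs; lra.
  apply: (Rle_trans _ (\big[Rplus/0]_i (if i \in o.1 then 2 else 0))).
    rewrite big_mkcond; apply: bigR_le => i _.
    by case: (Q i); case: (i \in o.1); lra.
  by rewrite -big_mkcond bigR_const Rmult_comm; exact: Rle_refl.
have -> : ptilde n G eps (final_msg n G d x S o h) g - sgn_dot _ P (S g) =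
  kappa eps / INR (n %/ G) * (corr + dev P S g x h).
  rewrite /ptilde /corr /deviation -bigR_add -/r -kr.
  rewrite (eq_bigr (fun i => kappa eps * bsgn (final_msg n G d x S o h i))); last first.
    by move=> i _; rewrite /msg_val /bsgn; case: final_msg; ring.
  rewrite [X in _ = _ * X](eq_bigr (fun i => bsgn (final_msg n G d x S o h i) - r)).
    rewrite bigR_scale bigR_sub bigR_const.
    have -> : #|[pred i | group_of n G i == nat_of_ord g]| = (n %/ G)%nat.
      exact: card_group.
    rewrite nE; set z := \big[Rplus/0]_(i | _) _; field; lra.
  by move=> i _; ring.
rewrite Rabs_mult (Rabs_pos_eq (_ / _)); last first.
  by apply/Rlt_le/Rdiv_lt_0_compat.
have -> : kappa eps * (Rabs (dev P S g x h) / INR (n %/ G) +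
   2 * INR #|o.1| * INR G / INR n) =
  kappa eps / INR (n %/ G) * (2 * INR #|o.1| + Rabs (dev P S g x h)).
  by rewrite nE; set z := Rabs _; field; lra.
apply: Rmult_le_compat_l; first by apply/Rlt_le/Rdiv_lt_0_compat.
by have := Rabs_triang corr (dev P S g x h); lra.
Qed.

(** * Noise level and union bound over the groups *)

Hypothesis beta01 : 0 < beta < 1.

Lemma log_gt0 : 0 < ln (4 * INR G / beta).
Proof.
have G1 : 1 <= INR G by apply: (le_INR 1); apply/leP.
rewrite -ln_1; apply: ln_increasing; first lra.
apply: (Rmult_lt_reg_r beta); first lra.
by rewrite /Rdiv Rmult_assoc Rinv_l; lra.
Qed.

(** Bound for an unnormalised group sum, chosen so that the exponent in [deviation_tail] is exactly
    [ln (4 G / beta)]. *)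
Definition threshold : R := 2 * INR (n %/ G) * noise.

Definition bad_group P x (S : {ffun 'I_G -> {set 'I_d}}) h (g : 'I_G) : bool :=
  Rltb threshold (Rabs (dev P S g x h)).

Lemma ptilde_close_good P x S (o : {set 'I_n} * {ffun 'I_n -> bool}) h (g : 'I_G) :
  ~~ bad_group P x S h g ->
  Rabs (ptilde n G eps (final_msg n G d x S o h) g - sgn_dot _ P (S g)) <=
  kappa eps * (2 * noise + 2 * INR #|o.1| * INR G / INR n).
Proof.
move=> /RltbP/Rnot_lt_le le; have k0 := kappa_gt0 _ eps0.
apply: Rle_trans (ptilde_close _ _ _ _ _ _) _.
apply: Rmult_le_compat_l; first lra.
apply: Rplus_le_compat_r; have [_ N0] := INRs_gt0.
apply: (Rmult_le_reg_r (INR (n %/ G))) => //.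
rewrite /Rdiv Rmult_assoc Rinv_l /threshold in le *; lra.
Qed.

(** Each two-sided tail costs [2 * beta / (4 G)], hence [beta / 2] over all [G] groups. *)
Lemma bad_groups_prob P S : is_distr d P ->
  honest_exp n d eps P (fun x h => \big[Rplus/0]_g indic (bad_group P x S h g))
  <= beta / 2.
Proof.
move=> Pd; have [G0 N0] := INRs_gt0; have L0 := log_gt0.
have n0 : 0 < INR n by apply/lt_0_INR/ltP.
have noise2 : noise * noise = 6 * INR G / INR n * ln (4 * INR G / beta).
  apply: sqrt_sqrt; apply: Rmult_le_pos; last lra.
  by apply/Rlt_le/Rdiv_lt_0_compat; lra.
rewrite honest_exp_sum.
apply: (Rle_trans _ (\big[Rplus/0]_(g < G) (beta / (2 * INR G)))); last first.
  by rewrite bigR_constT card_ord; apply: Req_le; field; lra.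
apply: bigR_le => g _.
have cQ : #|(fun i => group_of n G i == nat_of_ord g)| = (n %/ G)%nat.
  exact: card_group.
apply: Rle_trans (deviation_tail _ _ _ _ eps0 Pd _ _ _ _ _) _.
- by rewrite cQ divn_gt0 // dvdn_leq.
- rewrite /threshold; have := sqrt_pos (6 * INR G / INR n * ln (4 * INR G / beta)).
  rewrite -/noise => ?; apply: Rmult_le_pos; lra.
rewrite cQ.
have -> : threshold * threshold / (24 * INR (n %/ G)) = ln (4 * INR G / beta).
  have -> : threshold * threshold = 4 * INR (n %/ G) * INR (n %/ G) * (noise * noise).
    by rewrite /threshold; ring.
  by rewrite noise2 n_eq; set L := ln _; field; lra.
rewrite exp_Ropp exp_ln; last by apply: Rdiv_lt_0_compat; lra.
by apply: Req_le; field; lra.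
Qed.

(** * The two guarantees of the protocol *)

Lemma sum_indic_ge1 (I : finType) (b : pred I) (i : I) : b i ->
  1 <= \big[Rplus/0]_j indic (b j).
Proof.
move=> bi; rewrite (bigD1 i) //= bi /=.
have : 0 <= \big[Rplus/0]_(j | j != i) indic (b j).
  by apply: bigR_ge0 => j _; case: (indic01 (b j)).
lra.
Qed.

(** Half-size sets are balanced, so the means vanish; without a bad group every average is at most
    [kappa (2 noise + 2 m G / n)], which is below [2 alphaG]. Public sets are never unlucky, hence
    [T = 0]. *)
Lemma uniform_accepted (M : attacker n d G) : valid_attacker n d G m M ->
  1 - beta <= manip_prob n G d m eps beta (unif d) M false.
Proof.
move=> vM; have k0 := kappa_gt0 _ eps0.
have dR : 0 < INR d by apply/lt_0_INR/ltP.
have n0 : 0 < INR n by apply/lt_0_INR/ltP.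
have Ud : is_distr d (unif d).
  split=> [j|]; first exact/Rlt_le/Rinv_0_lt_compat.
  by rewrite /Rsum /unif bigR_constT card_ord; field; lra.
apply: (Rle_trans _ (1 - beta / 2 - 0)); first lra.
apply: (manip_prob_lower _ _ _ (fun x S h =>
  \big[Rplus/0]_g indic (bad_group (unif d) x S h g)) (fun=> 0)) => //.
- move=> x S o h vS cm.
  set s := \big[Rplus/0]_g _.
  have B0 : 0 <= s.
    by apply: bigR_ge0 => j _; case: (indic01 (bad_group (unif d) x S h j)).
  case: (boolP (raptor_rejects _ _ _ _ _ _)) => [/existsP[g /RltbP rej]|_] /=; last lra.
  suff bg : bad_group (unif d) x S h g.
    have s1 : 1 <= s := sum_indic_ge1 _ (bad_group (unif d) x S h) _ bg.
    lra.
  apply/negP => /negP gg; have := ptilde_close_good _ _ _ o _ _ gg.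
  have -> : sgn_dot _ (unif d) (S g) = 0.
    rewrite /sgn_dot /unif.
    under eq_bigr => j _ do rewrite Rmult_comm.
    rewrite bigR_scale (sgn_sum _ _ card_half) ?Rmult_0_r //.
    by move/forallP: vS => /(_ g)/eqP.
  rewrite Rminus_0_r cm; move: rej; rewrite /alphaG -/noise.
  set z := 2 * INR m * INR G / INR n.
  have z0 : 0 <= z.
    apply: Rmult_le_pos; last exact/Rlt_le/Rinv_0_lt_compat.
    by have := pos_INR m; have := pos_INR G => *; apply: Rmult_le_pos; lra.
  by have := Rmult_le_pos _ _ (Rlt_le _ _ k0) z0; lra.
- by move=> S _; exact: bad_groups_prob.
- by rewrite big1 //; lra.
Qed.

(** Cauchy-Schwarz, read off from the nonnegative variance of [|q j|] around its mean [D / d]. *)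
Lemma sqnorm_l1 (q : 'I_d -> R) D : D = \big[Rplus/0]_j Rabs (q j) ->
  D * D <= INR d * sqnorm _ q.
Proof.
move=> DE; have dR : 0 < INR d by apply/lt_0_INR/ltP.
have : 0 <= \big[Rplus/0]_j ((Rabs (q j) - D / INR d) * (Rabs (q j) - D / INR d)).
  by apply: bigR_ge0 => j _; apply: Rle_0_sqr.
rewrite (eq_bigr (fun j => (q j * q j + (D / INR d * (D / INR d))) -
   2 * (D / INR d) * Rabs (q j))); last first.
  by move=> j _; rewrite /Rabs; case: Rcase_abs => _; ring.
rewrite bigR_sub bigR_add bigR_constT card_ord bigR_scale -DE -/(sqnorm _ q) => le.
have := Rmult_le_compat_l _ _ _ (Rlt_le _ _ dR) le.
set V := sqnorm _ q.
have -> : INR d * (V + INR d * (D / INR d * (D / INR d)) - 2 * (D / INR d) * D) =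
  INR d * V - D * D by field; lra.
lra.
Qed.

Lemma nonuniform_rejected (P : 'I_d -> R) (M : attacker n d G) :
  valid_attacker n d G m M -> is_distr d P -> (2 <= G)%nat -> (0 < m)%nat ->
  (11 / 12) ^ G <= beta / 2 ->
  40 * kappa eps * (sqrt (INR d * INR G / INR n * ln (INR G / beta))
     + INR m * INR G * sqrt (INR d) / INR n) <= L1dist d P (unif d) ->
  1 - beta <= manip_prob n G d m eps beta P M true.
Proof.
move=> vM Pd G2 m0 pow far.
have k0 := kappa_gt0 _ eps0; have [G0 N0] := INRs_gt0.
have dR : 0 < INR d by apply/lt_0_INR/ltP.
have n0 : 0 < INR n by apply/lt_0_INR/ltP.
have mR : 0 < INR m by apply/lt_0_INR/ltP.
have sd : 0 < sqrt (INR d) by apply: sqrt_lt_R0.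
have sdd : sqrt (INR d) * sqrt (INR d) = INR d by apply: sqrt_sqrt; lra.
have GR : 2 <= INR G by apply: (le_INR 2); apply/leP.
(* Since [G >= 2], [ln 4 <= 2 ln (G / beta)]; the logarithm in [noise] is thus comparable to the one
   in the distance hypothesis. *)
have LE : ln (4 * INR G / beta) <= 3 * ln (INR G / beta).
  have -> : 4 * INR G / beta = 2 * (2 * (INR G / beta)) by field; lra.
  have Gb : 0 < INR G / beta by apply: Rdiv_lt_0_compat; lra.
  rewrite 2?ln_mult; try lra.
  have : ln 2 < ln (INR G / beta).
    apply: ln_increasing; first lra.
    apply: (Rmult_lt_reg_r beta); first lra.
    by rewrite /Rdiv Rmult_assoc Rinv_l; lra.
  lra.
have L0 := log_gt0.
set lG := ln (INR G / beta) in LE far.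
pose r := sqrt (INR G / INR n * lG).
have Gn0 : 0 < INR G / INR n by apply: Rdiv_lt_0_compat.
have r0 : 0 <= r by apply: sqrt_pos.
(* The factor under the root is at most [6 * 3 = 18], rounded up to [5 * 5]. *)
have noise_r : noise <= 5 * r.
  rewrite /noise /r -{1}(sqrt_square 5); last lra.
  rewrite -sqrt_mult; try nra.
  apply: sqrt_le_1_alt.
  have -> : 6 * INR G / INR n * ln (4 * INR G / beta) =
    INR G / INR n * (6 * ln (4 * INR G / beta)) by rewrite /Rdiv; ring.
  have -> : 5 * 5 * (INR G / INR n * lG) = INR G / INR n * (25 * lG) by ring.
  by apply: Rmult_le_compat_l; lra.
set D := L1dist d P (unif d) in far.
pose z := INR m * INR G / INR n.
have z0 : 0 < z by apply: Rdiv_lt_0_compat => //; apply: Rmult_lt_0_compat.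
have farD : 40 * kappa eps * (r + z) * sqrt (INR d) <= D.
  apply: Rle_trans far; apply: Req_le.
  have -> : INR d * INR G / INR n * lG = INR d * (INR G / INR n * lG).
    by rewrite /Rdiv; ring.
  rewrite sqrt_mult; [|lra|nra].
  by rewrite -/r /z; field; lra.
pose q j := P j - unif d j.
have q0 : \big[Rplus/0]_j q j = 0.
  rewrite bigR_sub; case: Pd => _; rewrite /Rsum => ->.
  by rewrite /unif bigR_constT card_ord; field; lra.
have DV := sqnorm_l1 q D erefl.
have a0 : 0 < 20 * kappa eps * (r + z) by apply: Rmult_lt_0_compat; lra.
(* Half of the constant 40 is lost here, as [|q|_2 / 2 >= D / (2 sqrt d)]. *)
have V4 : 20 * kappa eps * (r + z) * (20 * kappa eps * (r + z)) <= sqnorm _ q / 4.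
  set a := 20 * kappa eps * (r + z) in a0 *.
  have aD : 2 * a * sqrt (INR d) <= D by rewrite /a; lra.
  have a2 : 0 <= 2 * a * sqrt (INR d) by apply: Rmult_le_pos; lra.
  have := Rmult_le_compat _ _ _ _ a2 a2 aD aD.
  have -> : 2 * a * sqrt (INR d) * (2 * a * sqrt (INR d)) =
     INR d * (4 * (a * a)) by rewrite -{3}sdd; ring.
  move=> h1; have h2 := Rle_trans _ _ _ h1 DV.
  by have := Rmult_le_reg_l _ _ _ dR h2; lra.
have V0 : 0 < sqnorm _ q by have := Rmult_lt_0_compat _ _ a0 a0; lra.
pose weak (A : {set 'I_d}) := Rltb (sgn_dot _ q A * sgn_dot _ q A) (sqnorm _ q / 4).
have dT : (0 < #|'I_d|)%nat by rewrite card_ord.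
have anti := half_anticoncentration _ _ card_half _ q0 dT V0.
apply: (Rle_trans _ (1 - beta / 2 - beta / 2)); first lra.
(* The product of indicators is 1 exactly when every public set is weak; this event and the bad
   groups cost [beta / 2] each. *)
apply: (manip_prob_lower _ _ _ (fun x S h =>
  \big[Rplus/0]_g indic (bad_group P x S h g))
  (fun S => \big[Rmult/1]_g indic (weak (S g)))) => //.
- move=> x S o h vS cm.
  set s := \big[Rplus/0]_g _.
  have B0 : 0 <= s.
    by apply: bigR_ge0 => j _; case: (indic01 (bad_group P x S h j)).
  set w := \big[Rmult/1]_g _.
  have T0 : 0 <= w.
    by apply: bigR_prod_ge0 => j _; case: (indic01 (weak (S j))).
  case: (boolP (raptor_rejects _ _ _ _ _ _)) => [_|acc] /=; first lra.
  case: (boolP [forall g, weak (S g)]) => [/forallP wk|].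
    have -> : w = 1 by rewrite /w big1 // => g _; rewrite wk.
    lra.
  rewrite negb_forall => /existsP[g /RltbP/Rnot_lt_le strong].
  suff bg : bad_group P x S h g.
    have s1 : 1 <= s := sum_indic_ge1 _ (bad_group P x S h) _ bg.
    lra.
  apply/negP => /negP gg; have := ptilde_close_good _ _ _ o _ _ gg.
  have -> : sgn_dot _ P (S g) = sgn_dot _ q (S g).
    rewrite /sgn_dot /q /unif.
    rewrite [RHS](eq_bigr (fun j => sgn _ (S g) j * P j - / INR d * sgn _ (S g) j)).
      rewrite bigR_sub bigR_scale (sgn_sum _ _ card_half) ?Rmult_0_r ?Rminus_0_r //.
      by move/forallP: vS => /(_ g)/eqP.
    by move=> j _ /=; set u := sgn _ _ _; set v := P j; ring.
  move: acc; rewrite negb_exists => /forallP/(_ g)/RltbP/Rnot_lt_le.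
  rewrite /alphaG -/noise cm.
  have -> : 2 * INR m * INR G / INR n = 2 * z by rewrite /z /Rdiv; ring.
  set y := sgn_dot _ q (S g) in strong *; set p := ptilde _ _ _ _ _ => le1 le2.
  have ylow : 20 * kappa eps * (r + z) <= Rabs y.
    apply: Rsqr_incr_0_var; last exact: Rabs_pos.
    by rewrite -Rsqr_abs /Rsqr; lra.
  (* Acceptance gives [|p| <= kappa (10 r + 4 z)] and closeness [|y - p| <= kappa (10 r + 2 z)].
     Together they fall strictly below [20 kappa (r + z)] because [z > 0], contradicting [ylow]. *)
  have := Rabs_triang p (y - p); rewrite Rabs_minus_sym in le2.
  have -> : p + (y - p) = y by ring.
  have := Rmult_le_compat_l _ _ _ (Rlt_le _ _ k0) noise_r.
  have := Rmult_lt_0_compat _ _ k0 z0.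
  lra.
- by move=> S _; exact: bad_groups_prob.
- rewrite (validS_prod (fun A => indic (weak A))) validS_count.
  apply: (Rle_trans _ ((11 / 12 * nhalf 'I_d k) ^ G)).
    apply: pow_incr; split; last exact: anti.
    by apply: bigR_ge0 => A _; case: (indic01 (weak A)).
  rewrite Rpow_mult_distr; apply: Rmult_le_compat_r => //.
  exact/Rlt_le/pow_lt/nhalf_gt0/card_half.
Qed.

End Game.

(** * Choice of the number of groups and final assembly *)

Definition ngroups (beta : R) : nat := (Z.to_nat (up (12 * ln (2 / beta)))).+2.

Lemma ngroups_bounds beta : 0 < beta < 1 ->
  12 * ln (2 / beta) <= INR (ngroups beta) <= 12 * ln (2 / beta) + 3.
Proof.
move=> b01.
have l0 : 0 < ln (2 / beta).
  rewrite -ln_1; apply: ln_increasing; first lra.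
  apply: (Rmult_lt_reg_r beta); first lra.
  by rewrite /Rdiv Rmult_assoc Rinv_l; lra.
have [u1 u2] := archimed (12 * ln (2 / beta)).
have up0 : (0 <= up (12 * ln (2 / beta)))%Z.
  by apply: le_IZR; lra.
rewrite /ngroups !S_INR INR_IZR_INZ Z2Nat.id //; lra.
Qed.

Theorem mainTheorem16 :
  exists c : R, exists Gf : R -> nat,
    (forall beta, 0 < beta < 1 -> (0 < Gf beta)%nat) /\
    (exists a b beta0 : R, 0 < a /\ 0 < b /\ 0 < beta0 < 1 /\
       forall beta, 0 < beta < beta0 ->
         a * ln (/ beta) <= INR (Gf beta) <= b * ln (/ beta)) /\
    forall (beta eps : R) (m n d : nat),
      0 < beta < 1 -> 0 < eps ->
      (0 < m)%nat -> (m <= n)%nat -> (Gf beta %| n)%nat ->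
      (0 < d)%nat -> ~~ odd d ->
      forall M : attacker n d (Gf beta), valid_attacker n d (Gf beta) m M ->
        1 - beta <= manip_prob n (Gf beta) d m eps beta (unif d) M false /\
        forall P : 'I_d -> R, is_distr d P ->
          c * kappa eps *
            (sqrt (INR d * INR (Gf beta) / INR n * ln (INR (Gf beta) / beta))
             + INR m * INR (Gf beta) * sqrt (INR d) / INR n)
            <= L1dist d P (unif d) ->
          1 - beta <= manip_prob n (Gf beta) d m eps beta P M true.
Proof.
exists 40, ngroups; split=> //; split.
  (* For [beta < exp (-1)] one has [ln (/ beta) >= 1], which absorbs the additive
     [12 ln 2 + 3 <= 15] into the slope [12 + 15 = 27]. *)
  exists 12, 27, (exp (-1)); split; [lra | split; [lra | split]].
    by split; [exact: exp_pos | rewrite -exp_0; apply: exp_increasing; lra].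
  move=> beta [b0 b1].
  have e1 : exp (-1) < 1 by rewrite -exp_0; apply: exp_increasing; lra.
  have bnd := ngroups_bounds beta; move/(_ (conj b0 (Rlt_trans _ _ _ b1 e1))) in bnd.
  have l1 : 1 <= ln (/ beta).
    rewrite ln_Rinv //; have := ln_increasing _ _ b0 b1; rewrite ln_exp; lra.
  have l2 : 0 < ln 2 < 1.
    split; first by rewrite -ln_1; apply: ln_increasing; lra.
    rewrite -[X in _ < X]ln_exp; apply: ln_increasing; first lra.
    by have := exp_ineq1 1; lra.
  have E : ln (2 / beta) = ln 2 + ln (/ beta).
    by rewrite ln_mult //; [lra | exact: Rinv_0_lt_compat].
  by rewrite E in bnd; lra.
move=> beta eps m n d b01 e0 m0 mn Gn d0 dev M vM.
have n0 : (0 < n)%nat by apply: leq_trans mn.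
split; first exact: uniform_accepted.
(* The [.+2] in [ngroups] provides [2 <= G] by computation; only the bound on [(11 / 12) ^ G]
   remains. *)
move=> P Pd far; apply: nonuniform_rejected far => //.
have bnd := ngroups_bounds beta b01.
(* Thus [(11 / 12) ^ G <= exp (- G / 12)], at most [beta / 2] once [G >= 12 ln (2 / beta)]. *)
have : 1 + -1 / 12 <= exp (-1 / 12) by apply: exp_ineq1_le.
move=> e12; apply: (Rle_trans _ (exp (-1 / 12) ^ ngroups beta)).
  by apply: pow_incr; lra.
rewrite -Rpower_pow; last exact: exp_pos.
rewrite /Rpower ln_exp -[X in _ <= X]exp_ln; last lra.
apply: exp_le_compat.
have -> : beta / 2 = / (2 / beta) by field; lra.
rewrite ln_Rinv; last by apply: Rdiv_lt_0_compat; lra.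
lra.
Qed.
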